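(* Let $d \ge 1$. There exists a constant $c_d > 0$, depending only on $d$, with the following property. For every real symmetric matrix $X \in \mathrm{Sym}_d(\mathbb{R})$ and every real number $N \ge 1$, there exist integral matrices $Q, P \in \mathrm{Mat}_{d}(\mathbb{Z})$ satisfying $QQ^{\mathrm T} + PP^{\mathrm T} \in \mathrm{GL}_d(\mathbb{R})$ and $QP^{\mathrm T} = PQ^{\mathrm T}$ such that $$\|QX + P\|_{\mathrm{op}} \le \frac{c_d}{N}, \qquad \|Q\|_{\mathrm{op}} \le N.$$ Consequently, for every $X \in \mathrm{Sym}_d(\mathbb{R})$ there exist infinitely many pairs $(Q,P)$ of matrices in $\mathrm{Mat}_d(\mathbb{Z})$ with $Q \neq 0$ satisfying $QQ^{\mathrm T} + PP^{\mathrm T} \in \mathrm{GL}_d(\mathbb{R})$, $QP^{\mathrm T} = PQ^{\mathrm T}$ and $$\|QX + P\|_{\mathrm{op}} \le \frac{c_d}{\|Q\|_{\mathrm{op}}}.$$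
   Context: $\mathrm{Sym}_d(\mathbb{R})$ is the space of real symmetric $d\times d$ matrices. $\|\cdot\|_{\mathrm{op}}$ is the operator norm on $d \times d$ matrices with respect to the standard Euclidean norm on $\mathbb{R}^d$. The pair $(Q,P)$ is viewed as a $d \times 2d$ matrix with $d\times d$ blocks $Q$ and $P$. *)

(* Defs.v *)
From HB Require Import structures.
From mathcomp Require Import all_boot all_order all_algebra.
From mathcomp Require Import sesquilinear.
From mathcomp Require Import boolp classical_sets cardinality reals.
Set Implicit Arguments.
Unset Strict Implicit.
Unset Printing Implicit Defensive.
Import Order.TTheory GRing.Theory Num.Theory.
Local Open Scope ring_scope.
Local Open Scope classical_set_scope.

Definition enorm (R : realType) (n : nat) (v : 'cV[R]_n) : R :=
  Num.sqrt (\sum_(i < n) v i 0 ^+ 2).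

(* The norm that MathComp-Analysis puts on matrices is the maximum of the
   entries, hence the operator norm for the Euclidean norm is defined here. *)
Definition opnorm (R : realType) (m n : nat) (M : 'M[R]_(m, n)) : R :=
  sup [set enorm (M *m v) | v in [set v : 'cV[R]_n | enorm v <= 1]].

(* [sup] is the junk value 0 on sets that are empty or unbounded above; this
   does not happen in [opnorm]. *)
Lemma has_sup_opnorm (R : realType) (m n : nat) (M : 'M[R]_(m, n)) :
  has_sup [set enorm (M *m v) | v in [set v : 'cV[R]_n | enorm v <= 1]].
Proof.
split.
  exists (enorm (M *m 0)), 0 => //=; rewrite /enorm big1 ?sqrtr0 // => i _.
  by rewrite mxE expr0n.
exists (Num.sqrt (\sum_(i < m) (\sum_(j < n) `|M i j|) ^+ 2)) => _ [v /= v1 <-].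
apply: ler_wsqrtr; apply: ler_sum => i _.
rewrite -real_normK ?num_real // lerXn2r ?nnegrE ?sumr_ge0 //.
rewrite mxE (le_trans (ler_norm_sum _ _ _)) //; apply: ler_sum => j _.
rewrite normrM ler_piMr // (le_trans _ v1) // -sqrtr_sqr; apply: ler_wsqrtr.
by rewrite (bigD1 j) //= lerDl sumr_ge0 // => k _; rewrite sqr_ge0.
Qed.

(* Main.v *)
Require Import Defs.
From HB Require Import structures.
From mathcomp Require Import all_boot all_order all_algebra.
From mathcomp Require Import sesquilinear.
From mathcomp Require Import boolp classical_sets cardinality reals.
From mathcomp Require Import ring lra zify.
Set Implicit Arguments.
Unset Strict Implicit.
Unset Printing Implicit Defensive.
Import Order.TTheory GRing.Theory Num.Theory.
Local Open Scope ring_scope.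
Local Open Scope classical_set_scope.

(* The rows of (Q, P) must span a Lagrangian sublattice of Z^2d.  For
   t = N / K, with K depending only on d, the matrix g = ((1/t, t X), (0, t)) is
   symplectic since X is symmetric, and (q, p) g = (q / t, t (q X + p)); so it suffices to find, for
   any real symplectic g, independent integral vectors b_1, ..., b_d spanning an
   isotropic space with |b_i g| bounded in terms of d only.

   They are chosen greedily: b_(k+1) is symplectically orthogonal to b_1, ..., b_k
   and has minimal length s_(k+1)^(1/2) > 0 after projection orthogonally to
   their span.  Subtracting a multiple of b_k from b_(k+1) and using the
   minimality of b_k gives s_k <= 4/3 s_(k+1).  Minimality also makes the b_i
   part of a Z-basis, so some integral c is symplectically orthogonal to
   b_1, ..., b_(d-1) with omega(b_d, c) = 1; comparing b_d with a suitable
   c + m b_d gives s_d <= 1 / s_d + s_d / 4.  Hence all s_i are bounded.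

   For the infinitude, if Q X + P = 0 for some admissible pair then its multiples
   are admissible; otherwise letting N grow makes the error arbitrarily small. *)

(** * Finite minimisation and primitive integral vectors *)

Lemma seq_argmin (R : realType) (T : eqType) (f : T -> R) (s : seq T) (x0 : T) :
  x0 \in s -> exists2 x, x \in s & forall y, y \in s -> f x <= f y.
Proof.
elim: s x0 => // a [|b s] IH x0 _.
  by exists a; rewrite ?mem_head // => y; rewrite inE => /eqP ->.
have [x xs xmin] := IH b (mem_head _ _).
have [ax|/ltW xa] := leP (f a) (f x).
  exists a => [|y]; first exact: mem_head.
  by rewrite inE => /predU1P[->//|/xmin]; apply: le_trans.
exists x => [|y]; first by rewrite inE xs orbT.
by rewrite inE => /predU1P[->//|/xmin].
Qed.

Lemma finite_argmin (R : realType) (T : choiceType) (f : T -> R) (A : set T) x0 :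
  finite_set A -> A x0 -> exists2 x, A x & forall y, A y -> f x <= f y.
Proof.
move=> /finite_seqP[s ->] /= /(seq_argmin f)[x xs xmin].
by exists x.
Qed.

Lemma finite_box (n m : nat) :
  finite_set [set v : 'rV[int]_n | forall i, `|v 0 i| <= m%:Z].
Proof.
pose f (w : 'rV['I_(m + m).+1]_n) : 'rV[int]_n := map_mx (fun o : 'I_(m + m).+1 => o%:Z - m%:Z) w.
apply: (@sub_finite_set _ _ [set f w | w in setT]); last first.
  by apply: finite_image; exact: finite_finset.
move=> v /= vm; exists (\row_i inord (absz (v 0 i + m%:Z))) => //.
apply/rowP => i; rewrite !mxE; have := vm i; rewrite ler_norml => /andP[lo hi].
have v0 : 0 <= v 0 i + m%:Z by rewrite -lerBlDr sub0r.
rewrite inordK; first by rewrite gez0_abs // addrK.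
by rewrite ltnS -lez_nat gez0_abs // PoszD lerD2r.
Qed.

(** The Smith normal form exhibits [b] as its invariant factor times a vector with an evident
    integral dual; primitivity makes that factor 1 or -1. *)
Lemma primitive_bezout (n : nat) (b : 'rV[int]_n) :
  b != 0 -> (forall (m : int) (u : 'rV[int]_n), b = m *: u -> `|m| = 1) ->
  exists f : 'cV[int]_n, b *m f = 1%:M.
Proof.
case: n b => [|n] b b0 prim; first by rewrite thinmx0 eqxx in b0.
have [L Lu [M Mu [s _ bE]]] := int_Smith_normal_form b.
pose e : 'rV[int]_n.+1 := delta_mx 0 0.
have bE' : b = s`_0 *: (L *m e *m M).
  rewrite {1}bE scalemxAl scalemxAr; congr (_ *m _ *m _).
  apply/rowP => j; rewrite !mxE eqxx -val_eqE /= eq_sym.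
  by case: eqP => _; rewrite ?mulr1 ?mulr0.
have s1 := prim _ _ bE'.
exists (s`_0 *: (invmx M *m e^T *m invmx L)).
rewrite bE' -scalemxAl -scalemxAr scalerA.
have -> : s`_0 * s`_0 = 1 by rewrite -expr2 -real_normK ?num_real // s1 expr1n.
rewrite scale1r !mulmxA mulmxK // -(mulmxA L) /e trmx_delta mul_delta_mx.
by rewrite (_ : delta_mx 0 0 = 1%:M) ?mulmx1 ?mulmxV //; apply/matrixP=> i j; rewrite !ord1 !mxE.
Qed.

(** * Operator norm against matrix entries *)

Lemma enorm_ge_entry (R : realType) (n : nat) (v : 'cV[R]_n) i :
  `|v i 0| <= enorm v.
Proof.
rewrite -sqrtr_sqr; apply: ler_wsqrtr.
by rewrite (bigD1 i) //= lerDl sumr_ge0 // => k _; rewrite sqr_ge0.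
Qed.

Lemma opnorm_ge_entry (R : realType) (m n : nat) (M : 'M[R]_(m, n)) i j :
  `|M i j| <= opnorm M.
Proof.
have -> : M i j = (M *m delta_mx j (0 : 'I_1)) i 0 by rewrite -colE mxE.
apply: le_trans (enorm_ge_entry _ i) _.
apply: sup_upper_bound; first exact: has_sup_opnorm.
exists (delta_mx j 0) => //=; rewrite /enorm (bigD1 j) //= big1 ?addr0.
  by rewrite mxE !eqxx expr1n sqrtr1.
by move=> k /negPf kj; rewrite mxE kj expr0n.
Qed.

Lemma opnorm_ge0 (R : realType) (m n : nat) (M : 'M[R]_(m, n)) : 0 <= opnorm M.
Proof.
apply: sup_upper_bound; first exact: has_sup_opnorm.
have z0 k : enorm (0 : 'cV[R]_k) = 0.
  by rewrite /enorm big1 ?sqrtr0 // => i _; rewrite mxE expr0n.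
by exists 0; rewrite /= ?z0 ?ler01 // mulmx0 z0.
Qed.

Lemma opnorm_gt0 (R : realType) (m n : nat) (M : 'M[R]_(m, n)) :
  M != 0 -> 0 < opnorm M.
Proof.
move=> M0; rewrite lt_neqAle opnorm_ge0 andbT; apply: contra M0 => /eqP M0.
apply/eqP/matrixP => i j; apply/eqP; rewrite mxE -normr_le0 M0.
exact: opnorm_ge_entry.
Qed.

(** Each entry of [M v] is at most [d a], so the norm is at most d^(3/2) a; rounding up to d^2
    avoids a root. *)
Lemma opnorm_le_entries (R : realType) (d : nat) (M : 'M[R]_d) (a : R) :
  0 <= a -> (forall i j, `|M i j| <= a) -> opnorm M <= (d ^ 2)%:R * a.
Proof.
move=> a0 Ma; apply: sup_le_ub; first by case: (has_sup_opnorm M).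
move=> _ [v /= v1 <-].
have Mv i : `|(M *m v) i 0| <= d%:R * a.
  rewrite mxE (le_trans (ler_norm_sum _ _ _)) //.
  have -> : d%:R * a = \sum_(j < d) a by rewrite sumr_const card_ord mulr_natl.
  apply: ler_sum => j _; rewrite normrM -[leRHS]mulr1 ler_pM //.
  exact: le_trans (enorm_ge_entry _ _) v1.
have d2a : 0 <= (d ^ 2)%:R * a by rewrite mulr_ge0.
rewrite -[leRHS]ger0_norm // -[leRHS]sqrtr_sqr; apply: ler_wsqrtr.
apply: (@le_trans _ _ (\sum_(i < d) (d%:R * a) ^+ 2)).
  apply: ler_sum => i _; rewrite -real_normK ?num_real //.
  by rewrite lerXn2r ?nnegrE ?mulr_ge0.
rewrite sumr_const card_ord -[leLHS]mulr_natl natrX !exprMn mulrA.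
rewrite ler_wpM2r ?sqr_ge0 // -exprS -exprD.
by rewrite -!natrX ler_nat; case: (d) => // k; rewrite leq_pexp2l.
Qed.

(** * Quadratic forms and their quotients *)

Local Notation "A ^r" := (map_mx intr A) (at level 2, format "A ^r").

Definition bil (R : comPzRingType) (n : nat) (S : 'M[R]_n) (u v : 'rV[R]_n) : R :=
  (u *m S *m v^T) 0 0.

Lemma bilDl (R : comPzRingType) n (S : 'M[R]_n) u u' v :
  bil S (u + u') v = bil S u v + bil S u' v.
Proof. by rewrite /bil !mulmxDl mxE. Qed.

Lemma bilZl (R : comPzRingType) n (S : 'M[R]_n) a u v :
  bil S (a *: u) v = a * bil S u v.
Proof. by rewrite /bil -!scalemxAl mxE. Qed.

Lemma bilC (R : comPzRingType) n (S : 'M[R]_n) u v :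
  S^T = S -> bil S u v = bil S v u.
Proof. move=> symS; have -> : bil S u v = (u *m S *m v^T)^T 0 0 by rewrite [RHS]mxE.
by rewrite !trmx_mul symS trmxK mulmxA. Qed.

Lemma bilDr (R : comPzRingType) n (S : 'M[R]_n) u v v' :
  bil S u (v + v') = bil S u v + bil S u v'.
Proof. by rewrite /bil linearD mulmxDr mxE. Qed.

Lemma bilZr (R : comPzRingType) n (S : 'M[R]_n) a u v :
  bil S u (a *: v) = a * bil S u v.
Proof. by rewrite /bil linearZ -scalemxAr mxE. Qed.

Lemma bil_gram (R : comPzRingType) n (g : 'M[R]_n) u :
  bil (g *m g^T) u u = \sum_j (u *m g) 0 j ^+ 2.
Proof.
rewrite /bil mulmxA -mulmxA -trmx_mul mxE; apply: eq_bigr => j _.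
by rewrite [X in _ * X]mxE expr2.
Qed.

(* The form induced by [S] on the quotient by [b]: the value at [v] is the
   minimum of [bil S] over the line [v + R b]. *)
Definition quot_form (R : fieldType) n (S : 'M[R]_n) (b : 'rV[R]_n) : 'M[R]_n :=
  S - (bil S b b)^-1 *: (S *m b^T *m (b *m S)).

Lemma mul_quot_form (R : fieldType) n (S : 'M[R]_n) b x :
  x *m quot_form S b = (x - (bil S x b / bil S b b) *: b) *m S.
Proof.
rewrite mulmxBr mulmxBl; congr (_ - _).
rewrite -scalemxAr !mulmxA [x *m S *m b^T]mx11_scalar -/(bil S x b).
by rewrite mul_scalar_mx -!scalemxAl scalerA mulrC.
Qed.

Lemma bil_quot_form (R : fieldType) n (S : 'M[R]_n) b u v :
  bil (quot_form S b) u v = bil S u v - bil S u b * bil S b v / bil S b b.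
Proof.
rewrite {1}/bil mul_quot_form -/(bil S _ v) -scaleNr bilDl bilZl.
by rewrite mulNr mulrAC.
Qed.

Lemma quot_form_sym (R : fieldType) n (S : 'M[R]_n) b :
  S^T = S -> (quot_form S b)^T = quot_form S b.
Proof.
by move=> symS; rewrite /quot_form linearB linearZ /= !trmx_mul symS trmxK !mulmxA.
Qed.

Lemma quot_form_self (R : fieldType) n (S : 'M[R]_n) b :
  bil S b b != 0 -> b *m quot_form S b = 0.
Proof. by move=> b0; rewrite mul_quot_form divff // scale1r subrr mul0mx. Qed.

(** [S H S = S] makes [H] a generalised inverse of [S]. This survives in the quotient: its form is
    [A S = S A^T] and is fixed by right multiplication by [A^T]. *)
Lemma quot_form_proj (R : fieldType) n (S H : 'M[R]_n) b :
  S^T = S -> S *m H *m S = S -> bil S b b != 0 ->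
  quot_form S b *m H *m quot_form S b = quot_form S b.
Proof.
move=> symS SHS b0; have symX := quot_form_sym b symS.
pose A := 1%:M - (bil S b b)^-1 *: (S *m b^T *m b).
have XE : quot_form S b = A *m S.
  by rewrite mulmxBl mul1mx -scalemxAl -(mulmxA (S *m _)).
have XE' : quot_form S b = S *m A^T by rewrite -{1}symX XE trmx_mul symS.
have XA : quot_form S b *m A^T = quot_form S b.
  rewrite linearB linearZ /= trmx1 mulmxBr mulmx1 -scalemxAr !trmx_mul trmxK mulmxA.
  by rewrite -{2}symX -trmx_mul quot_form_self // linear0 mul0mx scaler0 subr0.
transitivity (A *m (S *m H *m S) *m A^T); first by rewrite {1}XE XE' !mulmxA.
by rewrite SHS -XE XA.
Qed.

(** * Symplectic matrices *)

Definition symp (A : pzRingType) (d : nat) : 'M[A]_(d + d) :=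
  block_mx 0 1%:M (- 1%:M) 0.
Arguments symp {A d}.

Lemma tr_symp (A : pzRingType) d : (@symp A d)^T = - symp.
Proof.
by rewrite tr_block_mx opp_block_mx !trmx0 !oppr0 opprK raddfN /= trmx1.
Qed.

Lemma symp_mulT (A : pzRingType) d : @symp A d *m symp^T = 1%:M.
Proof.
rewrite tr_symp mulmxN mulmx_block !mul0mx !mulmx0 mulmxN mulNmx !mul1mx.
by rewrite !addr0 add0r opp_block_mx !opprK !oppr0 -scalar_mx_block.
Qed.

Lemma sympT_mul (A : comPzRingType) d : (@symp A d)^T *m symp = 1%:M.
Proof. exact/mulmx1C/symp_mulT. Qed.

Lemma symp_alt (A : comPzRingType) d (v : 'rV[A]_(d + d)) : v *m symp *m v^T = 0.
Proof.
rewrite -[v]hsubmxK tr_row_mx mul_row_block !mulmx0 add0r addr0 mul_row_col.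
rewrite mulmxN !mulmx1 mulNmx; apply/matrixP => i j; rewrite !mxE addrC -sumrB big1 // => k _.
by rewrite !mxE !ord1; ring.
Qed.

Lemma map_symp (A B : pzRingType) (f : {rmorphism A -> B}) d :
  map_mx f (@symp A d) = symp.
Proof. by rewrite map_block_mx !raddf0 map_mxN map_mx1. Qed.

Definition symplectic (A : pzRingType) d (g : 'M[A]_(d + d)) : Prop :=
  g *m symp *m g^T = symp.

Lemma symplectic_inv (A : comPzRingType) d (g : 'M[A]_(d + d)) :
  symplectic g -> g *m (symp *m g^T *m symp^T) = 1%:M.
Proof. by move=> sg; rewrite !mulmxA sg symp_mulT. Qed.

(** For symplectic [g] this is the inverse of the Gram matrix [g g^T]; its value at [x] is the
    squared length of [x symp g]. *)
Definition dual_form (A : pzRingType) d (g : 'M[A]_(d + d)) : 'M[A]_(d + d) :=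
  symp *m (g *m g^T) *m symp^T.

Lemma dual_formK (A : comPzRingType) d (g : 'M[A]_(d + d)) :
  symplectic g -> g *m g^T *m dual_form g = 1%:M.
Proof.
move=> sg; have sgT : g^T *m symp *m g = symp.
  have /mulmx1C/(congr1 (fun M => symp^T *m M)) := symplectic_inv sg.
  rewrite !mulmxA sympT_mul mul1mx mulmx1 tr_symp mulmxN mulNmx.
  exact: oppr_inj.
transitivity (g *m (g^T *m symp *m g) *m g^T *m symp^T).
  by rewrite /dual_form !mulmxA.
by rewrite sgT sg symp_mulT.
Qed.

Lemma symplectic_mulI (A : comPzRingType) d (g : 'M[A]_(d + d)) m (x : 'M_(m, d + d)) :
  symplectic g -> x *m g = 0 -> x = 0.
Proof.
by move=> sg xg0; rewrite -[x]mulmx1 -(symplectic_inv sg) mulmxA xg0 mul0mx.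
Qed.

(** A bound on the length of [v g] bounds its entries, and multiplying by the inverse of [g] bounds
    those of [v]. *)
Lemma symplectic_discrete (R : realType) d (g : 'M[R]_(d + d)) (K : R) :
  symplectic g ->
  finite_set [set v : 'rV[int]_(d + d) | bil (g *m g^T) v^r v^r <= K].
Proof.
move=> sg; pose h := symp *m g^T *m symp^T.
pose c := \sum_i \sum_j `|h j i| * Num.sqrt K.
apply: sub_finite_set (finite_box _ (Num.bound c)) => v /= vK i.
have vE : v^r = v^r *m g *m h by rewrite -mulmxA symplectic_inv // mulmx1.
have vgK j : `|(v^r *m g) 0 j| <= Num.sqrt K.
  rewrite -sqrtr_sqr ler_wsqrtr // (le_trans _ vK) // bil_gram (bigD1 j) //=.
  by rewrite lerDl sumr_ge0 // => k _; rewrite sqr_ge0.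
have : `|(v 0 i)%:~R| <= c.
  have -> : (v 0 i)%:~R = v^r 0 i :> R by rewrite mxE.
  rewrite vE mxE (le_trans (ler_norm_sum _ _ _)) //.
  apply: (@le_trans _ _ (\sum_j `|h j i| * Num.sqrt K)).
    by apply: ler_sum => j _; rewrite normrM mulrC ler_wpM2l.
  rewrite /c [leRHS](bigD1 i) //= lerDl sumr_ge0 // => k _.
  by apply: sumr_ge0 => l _; rewrite mulr_ge0 ?sqrtr_ge0.
move=> vc; rewrite -(ler_int R) intr_norm ltW // (le_lt_trans vc) //.
exact: archi_boundP (le_trans (normr_ge0 _) vc).
Qed.

(** * Greedy construction of isotropic frames *)

(* An integral isotropic frame [b_1, ..., b_k], together with the form [S]
   that the Euclidean form [g g^T] induces on the quotient by its span.
   [r] bounds the loss of lifting a vector from that quotient, and every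
   nonzero vector of the symplectic orthogonal is, in the quotient, not much
   shorter than the vectors chosen so far. *)
Record partial_frame (R : realType) d (g : 'M[R]_(d + d)) k (C r : R)
    (B : 'M[int]_(k, d + d)) (S : 'M[R]_(d + d)) : Prop := PartialFrame {
  pf_sym : S^T = S;
  pf_proj : S *m dual_form g *m S = S;
  pf_le : forall v, bil S v v <= bil (g *m g^T) v v;
  pf_ker : forall x : 'rV_(d + d), x *m S = 0 -> exists y, x = y *m B^r;
  pf_vanish : B^r *m S = 0;
  pf_iso : B *m symp *m B^T = 0;
  pf_unimod : exists D, B *m D = 1%:M;
  pf_lift : forall v : 'rV[int]_(d + d), exists y : 'rV_k,
    bil (g *m g^T) (v + y *m B)^r (v + y *m B)^r <= bil S v^r v^r + r;
  pf_bound : forall v : 'rV[int]_(d + d), B *m symp *m v^T = 0 -> v^r *m S != 0 ->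
    r <= C * bil S v^r v^r /\
    forall i, bil (g *m g^T) (row i B)^r (row i B)^r <= C * bil S v^r v^r }.

Lemma partial_frame0 (R : realType) d (g : 'M[R]_(d + d)) (B : 'M[int]_(0, d + d)) :
  symplectic g -> partial_frame g 0 0 B (g *m g^T).
Proof.
move=> sg; split.
- by rewrite trmx_mul trmxK.
- by rewrite dual_formK // mul1mx.
- by [].
- move=> x x0; exists 0; rewrite mul0mx -[x]mulmx1 -(dual_formK sg) mulmxA.
  by rewrite x0 mul0mx.
- exact: flatmx0.
- exact: flatmx0.
- by exists 0; rewrite [RHS]flatmx0 flatmx0.
- by move=> v; exists 0; rewrite mul0mx !addr0.
- by move=> v _ _; rewrite !mul0r; split=> // -[].
Qed.

(** By [pf_proj], [bil S x x] is the squared length of [x S symp g], where [symp] and [g] are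
    invertible. *)
Lemma pf_posdef (R : realType) d (g : 'M[R]_(d + d)) k C r (B : 'M_(k, _)) S x :
  symplectic g -> partial_frame g C r B S -> x *m S != 0 -> 0 < bil S x x.
Proof.
move=> sg pf; have -> : bil S x x = bil (g *m g^T) (x *m S *m symp) (x *m S *m symp).
  by rewrite /bil !trmx_mul (pf_sym pf) -{1}(pf_proj pf) /dual_form !mulmxA.
rewrite bil_gram lt_neqAle sumr_ge0 ?andbT => [|j _]; last exact: sqr_ge0.
apply: contra => /eqP/esym x0.
have : x *m S *m symp *m g = 0.
  apply/rowP => j; apply/eqP; rewrite [X in _ == X]mxE -sqrf_eq0.
  by rewrite (psumr_eq0P _ x0) // => l _; exact: sqr_ge0.
move/(symplectic_mulI sg) => xS0; apply/eqP.
by rewrite -[LHS]mulmx1 -symp_mulT mulmxA xS0 mul0mx.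
Qed.

Lemma bil_congr (R : comPzRingType) n (S : 'M[R]_n) (u v : 'rV[R]_n) :
  S^T = S -> u *m S = v *m S -> bil S u u = bil S v v.
Proof.
move=> symS uv; rewrite /bil uv -!mulmxA; congr ((_ *m _) _ _).
by apply: trmx_inj; rewrite !trmx_mul !trmxK symS.
Qed.

Lemma pf_shift (R : realType) d (g : 'M[R]_(d + d)) k C r (B : 'M_(k, _)) S
    (v : 'rV_(d + d)) (y : 'rV_k) :
  partial_frame g C r B S -> (v + y *m B)^r *m S = v^r *m S.
Proof.
by move=> pf; rewrite map_mxD map_mxM mulmxDl -mulmxA (pf_vanish pf) mulmx0 addr0.
Qed.

Lemma pf_shift_iso (R : realType) d (g : 'M[R]_(d + d)) k C r (B : 'M_(k, _)) S
    (v : 'rV_(d + d)) (y : 'rV_k) :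
  partial_frame g C r B S ->
  B *m symp *m (v + y *m B)^T = B *m symp *m v^T.
Proof.
by move=> pf; rewrite linearD /= mulmxDr trmx_mul mulmxA (pf_iso pf) mul0mx addr0.
Qed.

(** A dimension count. The integral right inverse of [B] yields an integral projection onto its
    symplectic orthogonal, of corank at most [k]. If its image vanished in the quotient, it would
    lie in the span of [B], forcing 2d <= 2k. *)
Lemma pf_exists (R : realType) d (g : 'M[R]_(d + d)) k C r (B : 'M_(k, _)) S :
  partial_frame g C r B S -> (k < d)%N ->
  exists2 v : 'rV[int]_(d + d), B *m symp *m v^T = 0 & v^r *m S != 0.
Proof.
move=> pf kd; have [D BD] := pf_unimod pf.
pose F := (symp^T *m B^T) *m (D^T *m symp).
(* [1 - F] projects onto the symplectic orthogonal of [B]. *)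
have FB z : B *m symp *m (z *m (1%:M - F))^T = 0.
  rewrite trmx_mul linearB /= trmx1 mulmxA mulmxBr mulmx1 !trmx_mul !trmxK !mulmxA.
  rewrite -(mulmxA B symp) symp_mulT mulmx1 BD mul1mx subrr mul0mx.
  by [].
apply: contrapT => none; suff : (d + d <= k + k)%N by lia.
rewrite -{1}(mxrank1 R (d + d)) -(subrK F^r 1%:M).
apply: leq_trans (mxrank_add _ _) (leq_add _ _); last first.
  by rewrite map_mxM; apply: mulmx_max_rank.
apply: leq_trans (rank_leq_row B^r); apply/mxrankS/row_subP => i.
have [|y ->] := pf_ker pf (x := row i (1%:M - F^r)); last exact: submxMl.
apply: contrapT => /eqP iS; apply: none; exists (row i 1%:M *m (1%:M - F)) => //.
by rewrite -row_mul mul1mx map_row map_mxB map_mx1.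
Qed.

(** Since [S] is degenerate, its sublevel sets may be infinite. Lifting each class to a
    representative of length controlled by [S] and [r] leaves finitely many candidates no larger
    than a given one. *)
Lemma pf_minimal (R : realType) d (g : 'M[R]_(d + d)) k C r (B : 'M_(k, _)) S :
  symplectic g -> partial_frame g C r B S -> (k < d)%N ->
  exists b : 'rV[int]_(d + d),
    [/\ B *m symp *m b^T = 0, b^r *m S != 0,
        bil (g *m g^T) b^r b^r <= bil S b^r b^r + r &
        forall v : 'rV[int]_(d + d), B *m symp *m v^T = 0 -> v^r *m S != 0 ->
          bil S b^r b^r <= bil S v^r v^r].
Proof.
move=> sg pf kd; have lift v : B *m symp *m v^T = 0 -> v^r *m S != 0 ->
    exists w : 'rV[int]_(d + d), [/\ B *m symp *m w^T = 0, w^r *m S != 0,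
      bil (g *m g^T) w^r w^r <= bil S w^r w^r + r & bil S w^r w^r = bil S v^r v^r].
  move=> Bv vS; have [y yP] := pf_lift pf v; have vyS := pf_shift v y pf.
  have vyE := bil_congr (pf_sym pf) vyS.
  by exists (v + y *m B); rewrite (pf_shift_iso _ _ pf) vyS vyE.
have [v0 /lift/[apply]-[w0 [Bw0 w0S w0r _]]] := pf_exists pf kd.
pose A := [set w : 'rV[int]_(d + d) | [/\ B *m symp *m w^T = 0, w^r *m S != 0,
      bil (g *m g^T) w^r w^r <= bil S w^r w^r + r & bil S w^r w^r <= bil S w0^r w0^r]].
have Afin : finite_set A.
  apply: sub_finite_set (symplectic_discrete (bil S w0^r w0^r + r) sg).
  by move=> w [_ _ wr ww0] /=; rewrite (le_trans wr) // lerD2r.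
have [|b [Bb bS br bw0] bmin] :=
  finite_argmin (fun w => bil S w^r w^r) Afin (x0 := w0); first by [].
exists b; split=> // v /lift/[apply]-[w [Bw wS wr <-]].
have [ww0|/ltW w0w] := leP (bil S w^r w^r) (bil S w0^r w0^r); first exact: bmin.
exact: le_trans w0w.
Qed.

(** Size reduction: the part along [b] contributes [s (t + m)^2], and taking [m] to be an integer
    nearest to [-t] makes this at most [s / 4]. *)
Lemma quot_form_lift (R : realType) n (S : 'M[R]_n) (v b : 'rV_n) :
  S^T = S -> 0 < bil S b b ->
  exists m : int, bil S (v + m%:~R *: b) (v + m%:~R *: b)
                    <= bil (quot_form S b) v v + bil S b b / 4.
Proof.
move=> symS s0; set s := bil S b b; set t := bil S v b / s.
exists (- Num.floor (t + 2^-1)); set m : R := _%:~R.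
have [lo hi] : t + m <= 2^-1 /\ - 2^-1 <= t + m.
  rewrite /m rmorphN /=; have := floor_le_tmp (t + 2^-1); have := floorD1_gt (t + 2^-1).
  by rewrite intrD; lra.
have -> : bil S (v + m *: b) (v + m *: b) = bil (quot_form S b) v v + s * (t + m) ^+ 2.
  rewrite bil_quot_form !bilDl !bilDr !bilZl !bilZr (bilC b v symS) -/s /t.
  by field; rewrite gt_eqF.
rewrite lerD2l ler_pM2l //.
by move: (t + m) lo hi => x lo hi; nra.
Qed.

Lemma mul_quot_form0 (R : fieldType) n (S : 'M[R]_n) (b x : 'rV_n) :
  x *m S = 0 -> x *m quot_form S b = 0.
Proof.
by move=> xS0; rewrite mul_quot_form {1}/bil xS0 mul0mx mxE mul0r scale0r subr0.
Qed.

(** Modulo [B], a minimal [b] is primitive: if it were [m u], then [u] would also compete in the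
    minimisation, so [m^2 <= 1]. *)
Lemma pf_unimod_extend (R : realType) d (g : 'M[R]_(d + d)) k C r
    (B : 'M_(k, _)) S (b : 'rV[int]_(d + d)) :
  symplectic g -> partial_frame g C r B S ->
  B *m symp *m b^T = 0 -> b^r *m S != 0 ->
  (forall v : 'rV[int]_(d + d), B *m symp *m v^T = 0 -> v^r *m S != 0 ->
     bil S b^r b^r <= bil S v^r v^r) ->
  exists D, col_mx b B *m D = 1%:M.
Proof.
move=> sg pf Bb bS bmin; have [D BD] := pf_unimod pf.
(* The representative of [b] modulo [B] that is killed by [D]. *)
pose c := b + (- (b *m D)) *m B.
have cS : c^r *m S = b^r *m S by rewrite (pf_shift _ _ pf).
have Bc : B *m symp *m c^T = 0 by rewrite (pf_shift_iso _ _ pf).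
have cD : c *m D = 0 by rewrite mulmxDl -mulmxA BD mulmx1 subrr.
have c0 : c != 0 by apply: contra bS => /eqP c0; rewrite -cS c0 map_mx0 mul0mx.
have [f cf] : exists f : 'cV[int]_(d + d), c *m f = 1%:M.
  apply: primitive_bezout => // m u cE.
  have m0 : m != 0 by apply: contra c0 => /eqP m0; rewrite cE m0 scale0r.
  have Bu : B *m symp *m u^T = 0.
    apply/eqP; have /eqP := Bc.
    by rewrite cE linearZ /= -scalemxAr scalemx_eq0 (negPf m0).
  have uS : u^r *m S != 0.
    by apply: contra bS => /eqP uS; rewrite -cS cE map_mxZ -scalemxAl uS scaler0.
  have := bmin _ Bu uS; have := pf_posdef sg pf uS.
  rewrite -(bil_congr (pf_sym pf) cS) cE map_mxZ bilZl bilZr mulrA => u0.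
  rewrite ger_pMl // -intrM -[1]/(1%:~R) ler_int -expr2 => m1; nia.
(* Correcting the dual of [c] by a combination of columns of [D] kills [B e] and, as [c D = 0],
   keeps [c e = 1]. *)
pose e := f - D *m (B *m f).
have Be : B *m e = 0 by rewrite mulmxBr (mulmxA B D) BD mul1mx subrr.
have be : b *m e = 1%:M.
  have -> : b = c + b *m D *m B by rewrite /c mulNmx subrK.
  rewrite mulmxDl -!mulmxA Be !mulmx0 addr0.
  by rewrite mulmxBr cf (mulmxA c D) cD mul0mx subr0.
move: e Be be => e Be be.
exists (row_mx e (D - e *m (b *m D))); rewrite mul_col_row !mulmxBr !mulmxA.
by rewrite be Be BD mul1mx !mul0mx subrr subr0 -scalar_mx_block.
Qed.

(** Rounding along [b] adds [s / 4] to the lifting loss. If [q] is the new quotient value of [v],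
    minimality of [b] against a reduced [v + m b] gives [s <= q + s / 4], hence the factor 4/3. *)
Lemma pf_step (R : realType) d (g : 'M[R]_(d + d)) k C r
    (B : 'M_(k, _)) S (b : 'rV[int]_(d + d)) :
  symplectic g -> 0 <= C -> partial_frame g C r B S ->
  B *m symp *m b^T = 0 -> b^r *m S != 0 ->
  bil (g *m g^T) b^r b^r <= bil S b^r b^r + r ->
  (forall v : 'rV[int]_(d + d), B *m symp *m v^T = 0 -> v^r *m S != 0 ->
     bil S b^r b^r <= bil S v^r v^r) ->
  partial_frame g (4 / 3 * (1 + C)) (r + bil S b^r b^r / 4)
    (col_mx b B) (quot_form S b^r).
Proof.
move=> sg C0 pf Bb bS br bmin; have symS := pf_sym pf.
have s0 := pf_posdef sg pf bS; have s_neq0 := lt0r_neq0 s0.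
have bSX := quot_form_self s_neq0.
have shiftX (v : 'rV_(d + d)) m : (v + m *: b)^r *m quot_form S b^r = v^r *m quot_form S b^r.
  by rewrite map_mxD map_mxZ mulmxDl -scalemxAl bSX scaler0 addr0.
split.
- exact: quot_form_sym.
- exact: quot_form_proj (pf_proj pf) _.
- move=> v; apply: le_trans (pf_le pf v); rewrite bil_quot_form (bilC b^r v symS).
  by rewrite lerBlDr lerDl divr_ge0 ?(ltW s0) // -expr2 sqr_ge0.
- move=> x; rewrite mul_quot_form => /(pf_ker pf)[y yE].
  exists (row_mx (bil S x b^r / bil S b^r b^r)%:M y).
  by rewrite map_col_mx mul_row_col mul_scalar_mx -yE addrC subrK.
- rewrite map_col_mx mul_col_mx bSX mulmxBr -scalemxAr !mulmxA (pf_vanish pf).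
  by rewrite !mul0mx scaler0 subr0 col_mx0.
- rewrite mul_col_mx tr_col_mx mul_col_row symp_alt Bb (pf_iso pf).
  have -> : b *m symp *m B^T = - (B *m symp *m b^T)^T.
    by rewrite !trmx_mul trmxK tr_symp mulNmx mulmxN opprK mulmxA.
  by rewrite Bb trmx0 oppr0 block_mx0.
- exact: pf_unimod_extend pf Bb bS bmin.
- move=> v; have [m mP] := quot_form_lift v^r symS s0.
  have [y yP] := pf_lift pf (v + m *: b).
  exists (row_mx m%:M y); rewrite mul_row_col mul_scalar_mx addrA.
  rewrite (le_trans yP) // map_mxD map_mxZ addrCA addrC lerD2r.
  exact: mP.
- move=> v; rewrite !mul_col_mx -[0]col_mx0 => /eq_col_mx[bv Bv] vX.
  have [m mP] := quot_form_lift v^r symS s0.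
  have Bvm : B *m symp *m (v + m *: b)^T = 0.
    by rewrite linearD linearZ mulmxDr -scalemxAr Bb Bv scaler0 addr0.
  have vmS : (v + m *: b)^r *m S != 0.
    by apply: contra vX => /eqP vmS; rewrite -(shiftX v m) mul_quot_form0.
  have := bmin _ Bvm vmS; rewrite map_mxD map_mxZ => /le_trans/(_ mP).
  set s := bil S b^r b^r in s0 br *; set q := bil _ v^r v^r => sq.
  (* The old bound at [b] itself gives [r <= C s], so [b] has squared length at most [(1 + C) s]. *)
  have [rs rowB] := pf_bound pf Bb bS; rewrite -/s in rs rowB.
  have Cs : (1 + C) * s <= 4 / 3 * (1 + C) * q by nra.
  split=> [|i]; first by nra.
  case: (split_ordP i) => j ->.
    by rewrite rowKu row_id; rewrite -/s in br *; nra.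
  by rewrite rowKd (le_trans (rowB j)) //; nra.
Qed.

(** * Lagrangian frames of bounded length *)

(** The row space of [M] has dimension [d] and lies in its own orthogonal, of dimension 2d - d, so
    the two coincide. *)
Lemma lagrangian_orthogonal (F : fieldType) d (M : 'M[F]_(d, d + d)) D (x : 'rV_(d + d)) :
  M *m D = 1%:M -> M *m symp *m M^T = 0 -> M *m symp *m x^T = 0 ->
  exists y, x = y *m M.
Proof.
move=> MD MM Mx; apply/submxP.
have rkM : \rank M = d.
  apply/eqP; rewrite eqn_leq rank_leq_row -{1}(mxrank1 F d) -MD.
  exact: mxrankM_maxl.
have sub m (z : 'M_(m, d + d)) : M *m symp *m z^T = 0 -> (z <= kermx (symp *m M^T))%MS.
  move=> Mz; apply/sub_kermxP; apply: trmx_inj.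
  by rewrite !trmx_mul trmxK tr_symp mulmxN mulNmx Mz oppr0 trmx0.
apply: submx_trans (sub _ _ Mx) _; have := mxrank_leqif_sup (sub _ _ MM).
move=> [_ <-]; rewrite mxrank_ker -(mxrank_tr (symp *m _)) trmx_mul trmxK.
have -> : \rank (M *m symp^T) = d; last by rewrite addnK rkM.
rewrite mxrankMfree ?rkM // row_free_unit.
by have /mulmx1_unit[] := sympT_mul F d.
Qed.

Definition frame_const (R : realType) (k : nat) : R :=
  iter k (fun C => 4 / 3 * (1 + C)) 0.

Lemma frame_const_ge0 (R : realType) k : 0 <= frame_const R k.
Proof. by elim: k => [|k IH]; rewrite ?lexx //= -/(frame_const R k); nra. Qed.

Lemma partial_frame_exists (R : realType) d (g : 'M[R]_(d + d)) k :
  symplectic g -> (k <= d)%N ->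
  exists r (B : 'M_(k, _)) S, partial_frame g (frame_const R k) r B S.
Proof.
move=> sg; elim: k => [|k IH] kd.
  by exists 0, 0, (g *m g^T); exact: partial_frame0.
have [r [B [S pf]]] := IH (ltnW kd).
have [b [Bb bS br bmin]] := pf_minimal sg pf kd.
exists (r + bil S b^r b^r / 4), (col_mx b B), (quot_form S b^r).
exact: pf_step (frame_const_ge0 R k) pf Bb bS br bmin.
Qed.

(* For the last vector the quotient is a plane of covolume 1, and its shortest
   vector [b] satisfies Hermite's bound: if [c] is symplectically dual to [b],
   its component orthogonal to the frame has length [1 / |b|]. *)
Lemma last_vector_bound (R : realType) e (g : 'M[R]_(e.+1 + e.+1)) C r
    (B : 'M_(e, _)) S (b : 'rV[int]_(e.+1 + e.+1)) :
  symplectic g -> 0 <= C -> partial_frame g C r B S ->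
  B *m symp *m b^T = 0 -> b^r *m S != 0 ->
  bil (g *m g^T) b^r b^r <= bil S b^r b^r + r ->
  (forall v : 'rV[int]_(e.+1 + e.+1), B *m symp *m v^T = 0 -> v^r *m S != 0 ->
     bil S b^r b^r <= bil S v^r v^r) ->
  bil S b^r b^r <= 2.
Proof.
move=> sg C0 pf Bb bS br bmin.
have pf' := pf_step sg C0 pf Bb bS br bmin; have symS := pf_sym pf.
have s0 := pf_posdef sg pf bS; set s := bil S b^r b^r in pf' s0 *.
have [D MD] := pf_unimod pf'; set M : 'M[int]_(1 + e, _) := col_mx b B in pf' MD.
(* The column of [D] dual to [b], turned by [symp] into a symplectic dual. *)
pose c := (symp^T *m lsubmx D)^T.
have [bc Bc] : b *m symp *m c^T = 1%:M /\ B *m symp *m c^T = 0.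
  rewrite trmxK !mulmxA -!(mulmxA _ symp) symp_mulT !mulmx1.
  move: MD; rewrite -{1}[D]hsubmxK /M mul_col_row.
  by rewrite (@scalar_mx_block _ 1 e) => /eq_block_mx[].
(* [w / s] pairs with [b] and [B] exactly as [c] does, so their difference lies in the Lagrangian
   span and vanishes in the quotient. *)
pose w := b^r *m S *m symp.
have wE (m : nat) (x : 'M_(m, e.+1 + e.+1)) : x *m symp *m w^T = x *m S *m b^r^T.
  by rewrite !trmx_mul symS !mulmxA -(mulmxA x) symp_mulT mulmx1.
have toRE m (x : 'M[int]_(m, e.+1 + e.+1)) (y : 'rV_(e.+1 + e.+1)) :
    x^r *m symp *m y^r^T = (x *m symp *m y^T)^r :> 'M[R]_(m, 1).
  by rewrite !map_mxM map_symp map_trmx.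
have cX : c^r *m quot_form S b^r = (s^-1 *: w) *m quot_form S b^r.
  apply/eqP; rewrite -subr_eq0 -mulmxBl; apply/eqP.
  have MDr : M^r *m D^r = 1%:M :> 'M[R]_(1 + e) by rewrite -map_mxM MD map_mx1.
  have Miso : M^r *m symp *m M^r^T = 0 :> 'M[R]_(1 + e).
    by rewrite map_trmx -(map_symp intr) -!map_mxM (pf_iso pf') map_mx0.
  have Mx : M^r *m symp *m (c^r - s^-1 *: w)^T = 0.
    rewrite linearB linearZ /= mulmxBr -scalemxAr toRE wE /M !mul_col_mx.
    rewrite bc Bc !map_col_mx !mul_col_mx (pf_vanish pf) mul0mx map_mx0 map_mx1.
    rewrite [b^r *m S *m _]mx11_scalar -/(bil S b^r b^r) -/s scale_col_mx scaler0.
    by rewrite scale_scalar_mx mulVf ?gt_eqF // subrr.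
  have [y ->] := @lagrangian_orthogonal _ e.+1 _ _ _ MDr Miso Mx.
  by rewrite -mulmxA (pf_vanish pf') mulmx0.
(* By [pf_proj] the squared length of [w] is [s], so that of [w / s] is [1 / s]. *)
have cs : bil (quot_form S b^r) c^r c^r <= s^-1.
  rewrite (bil_congr (pf_sym pf') cX) bilZl bilZr.
  rewrite -[leRHS]mulr1 -{2}(mulVf (lt0r_neq0 s0)) ler_pM2l ?invr_gt0 //.
  rewrite ler_pM2l ?invr_gt0 // (le_trans (pf_le pf' w)) //.
  rewrite /s {2}/bil -{1}(pf_proj pf) /bil /dual_form /w !trmx_mul symS !mulmxA.
  by [].
have [m mP] := quot_form_lift c^r symS s0.
have bb : b *m symp *m b^T = 0 := symp_alt b.
have bBT : b *m symp *m B^T = 0.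
  by have := pf_iso pf'; rewrite /M mul_col_mx tr_col_mx mul_col_row -[0]block_mx0 => /eq_block_mx[].
have Bcm : B *m symp *m (c + m *: b)^T = 0.
  by rewrite linearD linearZ mulmxDr -scalemxAr Bb Bc scaler0 addr0.
(* A vector in the span of [B] is orthogonal to [b], whereas this one pairs to 1 with it. *)
have cmS : (c + m *: b)^r *m S != 0.
  apply/eqP => /(pf_ker pf)[y yE].
  have : b^r *m symp *m (c + m *: b)^r^T = 0 :> 'M[R]_1.
    by rewrite yE trmx_mul mulmxA map_trmx -(map_symp intr) -!map_mxM bBT map_mx0 mul0mx.
  rewrite toRE linearD linearZ mulmxDr -scalemxAr bb bc scaler0 addr0 map_mx1.
  by move/matrixP/(_ 0 0); rewrite !mxE => /eqP; rewrite oner_eq0.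
have := bmin _ Bcm cmS; rewrite map_mxD map_mxZ => /le_trans/(_ mP).
rewrite -/s => sc; have : s * s^-1 = 1 by rewrite divff ?gt_eqF.
(* [s <= 1 / s + s / 4] gives [s^2 <= 4/3]; 2 is a rounder bound. *)
by move: (s^-1) cs => si cs ssi; nra.
Qed.

(** The bound on the last minimum controls everything: [pf_bound] at the last vector bounds [r] and
    all earlier rows by multiples of [s <= 2]. *)
Lemma lagrangian_frame (R : realType) e (g : 'M[R]_(e.+1 + e.+1)) :
  symplectic g -> exists2 B : 'M[int]_(e.+1, e.+1 + e.+1),
    B *m symp *m B^T = 0 /\ (exists D, B *m D = 1%:M) &
    forall i j, `|(B^r *m g) i j| <= Num.sqrt (2 * (1 + frame_const R e)).
Proof.
move=> sg; have [r [B [S pf]]] := partial_frame_exists sg (leqnSn e).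
have C0 := frame_const_ge0 R e.
have [b [Bb bS br bmin]] := pf_minimal sg pf (ltnSn e).
have pf' := pf_step sg C0 pf Bb bS br bmin.
have s2 := last_vector_bound sg C0 pf Bb bS br bmin.
have [rs rowB] := pf_bound pf Bb bS.
pose M : 'M[int]_(1 + e, _) := col_mx b B.
have rowM i : bil (g *m g^T) (row i M)^r (row i M)^r <= 2 * (1 + frame_const R e).
  case: (split_ordP i) => l ->; first by rewrite rowKu row_id; nra.
  by rewrite rowKd (le_trans (rowB l)) //; nra.
exists M; first by split; [exact: pf_iso pf' | exact: pf_unimod pf'].
move=> i j; rewrite -sqrtr_sqr ler_wsqrtr // (le_trans _ (rowM i)) //.
rewrite bil_gram (bigD1 j) //= map_row -row_mul [row _ _ _ _]mxE.
by rewrite lerDl sumr_ge0 // => k _; rewrite sqr_ge0.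
Qed.

(** * Approximation of symmetric matrices *)

(** If [x M M^T = 0], then [x M] has length zero, and [D] recovers [x = 0]. *)
Lemma gram_unitmx (R : realFieldType) m n (M : 'M[R]_(m, n)) D :
  M *m D = 1%:M -> M *m M^T \in unitmx.
Proof.
move=> MD; rewrite -row_free_unit; apply: inj_row_free => x xG.
have xM : x *m M = 0.
  have : bil (M *m M^T) x x = 0 by rewrite /bil xG mul0mx mxE.
  rewrite /bil mulmxA -mulmxA -trmx_mul mxE => /psumr_eq0P x0; apply/rowP => j.
  apply/eqP; rewrite [X in _ == X]mxE -sqrf_eq0 expr2.
  by have := x0 _ j isT; rewrite [X in _ * X]mxE => -> // i _; rewrite [X in _ * X]mxE -expr2 sqr_ge0.
by rewrite -[x]mulmx1 -MD mulmxA xM mul0mx.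
Qed.

Lemma symplectic_shear (F : fieldType) d (X : 'M[F]_d) (t : F) :
  X^T = X -> t != 0 -> symplectic (block_mx t^-1%:M (t *: X) 0 t%:M).
Proof.
move=> symX t0; rewrite /symplectic mulmx_block tr_block_mx.
rewrite !mulmx0 !mul0mx !mulmx1 !add0r !addr0 !mulmxN !mulmx1.
rewrite mulmx_block !tr_scalar_mx trmx0 [(t *: X)^T]linearZ /= symX !mulmx0 !mul0mx !addr0.
rewrite !mulNmx -!scalar_mxM mul_mx_scalar mul_scalar_mx addNr add0r.
by rewrite mulVf // divff // raddfN.
Qed.

Lemma dirichlet_symmetric (R : realType) e :
  exists2 c : R, 0 < c & forall (X : 'M[R]_e.+1) (N : R), X^T = X -> 1 <= N ->
    exists Q P : 'M[int]_e.+1,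
      [/\ (map_mx intr (Q *m Q^T + P *m P^T) : 'M[R]_e.+1) \in unitmx,
          Q *m P^T = P *m Q^T,
          opnorm (map_mx intr Q *m X + map_mx intr P) <= c / N &
          opnorm (map_mx intr Q : 'M[R]_e.+1) <= N].
Proof.
pose a := Num.sqrt (2 * (1 + frame_const R e)).
(* [K] turns the entry bound [a] into a norm bound. With [t = N / K], the norm of [Q] is at most
   [K t = N] and the error at most [K / t = K^2 / N]. *)
have [K KE] : exists K, K = (e.+1 ^ 2)%:R * a by eexists.
have a0 : 0 < a by rewrite sqrtr_gt0; have := frame_const_ge0 R e; nra.
have K0 : 0 < K by rewrite KE mulr_gt0 // ltr0n expn_gt0.
exists (K ^+ 2) => [|X N symX N1]; first exact: exprn_gt0.
have N0 : 0 < N by exact: lt_le_trans N1.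
pose t := N / K; have t0 : 0 < t by rewrite divr_gt0.
have [B [iso [D BD]] Bg] := lagrangian_frame (symplectic_shear symX (lt0r_neq0 t0)).
pose Q := lsubmx B; pose P := rsubmx B.
have BE : B = row_mx Q P by rewrite hsubmxK.
have BgE : B^r *m block_mx t^-1%:M (t *: X) 0 t%:M
    = row_mx (t^-1 *: Q^r) (t *: (Q^r *m X + P^r)).
  rewrite BE map_row_mx mul_row_block mulmx0 addr0 !mul_mx_scalar.
  by rewrite -scalemxAr scalerDr.
rewrite BgE -/a in Bg.
exists Q, P; split.
- have -> : Q *m Q^T + P *m P^T = B *m B^T by rewrite BE tr_row_mx mul_row_col.
  rewrite map_mxM -map_trmx; apply: (gram_unitmx (D := D^r)).
  by rewrite -map_mxM BD map_mx1.
- apply/eqP; rewrite -subr_eq0; apply/eqP; rewrite -iso BE tr_row_mx mul_row_block.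
  rewrite !mulmx0 add0r addr0 mulmxN !mulmx1 mul_row_col mulNmx.
  exact: addrC.
- have -> : K ^+ 2 / N = (e.+1 ^ 2)%:R * (a / t).
    by rewrite /t invf_div !mulrA -KE -expr2.
  apply: opnorm_le_entries => [|i j]; first by rewrite divr_ge0 // ltW.
  have := Bg i (rshift _ j); rewrite row_mxEr mxE normrM gtr0_norm //.
  by rewrite ler_pdivlMr // mulrC.
- have -> : N = (e.+1 ^ 2)%:R * (a * t).
    by rewrite /t mulrA -KE mulrCA divff ?mulr1 // gt_eqF.
  apply: opnorm_le_entries => [|i j]; first by rewrite mulr_ge0 // ltW.
  have := Bg i (lshift _ j); rewrite row_mxEl mxE normrM gtr0_norm ?invr_gt0 //.
  by rewrite mulrC ler_pdivrMr.
Qed.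

Theorem theorem1p1 (R : realType) (d : nat) (hd : (1 <= d)%N) :
  exists2 c : R, 0 < c &
    (forall (X : 'M[R]_d) (N : R), X \is symmetricmx -> 1 <= N ->
       exists Q P : 'M[int]_d,
         [/\ (map_mx intr (Q *m Q^T + P *m P^T) : 'M[R]_d) \in unitmx,
             Q *m P^T = P *m Q^T,
             opnorm (map_mx intr Q *m X + map_mx intr P) <= c / N &
             opnorm (map_mx intr Q : 'M[R]_d) <= N])
    /\
    (forall X : 'M[R]_d, X \is symmetricmx ->
       infinite_set
         [set QP : 'M[int]_d * 'M[int]_d |
            let: (Q, P) := QP in
            [/\ Q != 0,
                (map_mx intr (Q *m Q^T + P *m P^T) : 'M[R]_d) \in unitmx,
                Q *m P^T = P *m Q^T &
                opnorm (map_mx intr Q *m X + map_mx intr P)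
                  <= c / opnorm (map_mx intr Q : 'M[R]_d)]]).
Proof.
case: d hd => // e _; have [c c0 approx] := dirichlet_symmetric R e.
have symE (X : 'M[R]_e.+1) : X \is symmetricmx -> X^T = X.
  by move=> /is_hermitianmxP XE; rewrite [RHS]XE expr0 scale1r map_mx_id.
exists c => //; split=> [X N|X] /symE symX; first exact: approx.
set A := [set _ | _] => Afin.
pose err (QP : 'M[int]_e.+1 * 'M[int]_e.+1) : 'M[R]_e.+1 := (QP.1)^r *m X + (QP.2)^r.
have [[[Q0 P0] [AQP0 /= ker0]]|noker] := pselect (exists QP, A QP /\ err QP = 0).
  have [Q0nz _ _ _] := AQP0.
  have [i [j Qij]] : exists i j, Q0 i j != 0.
    apply: contrapT => none; move/eqP: Q0nz; apply; apply/matrixP => i j.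
    by rewrite mxE; apply: contrapT => /eqP ij; apply: none; exists i, j.
  (* Among exact solutions, one with maximal absolute entry at [(i, j)] is contradicted by its
     double. *)
  pose A0 := A `&` [set QP | err QP = 0].
  have A0fin : finite_set A0 by exact: finite_setIl.
  have [[Q P] [[Qnz QPu QP _] /= ker] Qmax] :=
    finite_argmin (fun QP : 'M_e.+1 * 'M_e.+1 => - `|(QP.1 i j)%:~R : R|)
      A0fin (conj AQP0 ker0).
  have err2 : err (2%:Z *: Q, 2%:Z *: P) = 0.
    by rewrite /err !map_mxZ -scalemxAl -scalerDr -/(err (Q, P)) ker scaler0.
  have /Qmax : A0 (2%:Z *: Q, 2%:Z *: P).
    split=> //; split.
    + by rewrite scalemx_eq0 negb_or Qnz.
    + rewrite !linearZ /= -!scalemxAl -!scalerDr !map_mxZ.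
      by rewrite !unitmxZ ?unitfE ?intr_eq0.
    + by rewrite !linearZ /= -!scalemxAl QP.
    + rewrite -/(err (2%:Z *: Q, 2%:Z *: P)) err2.
      apply: (@le_trans _ _ 0); last by rewrite divr_ge0 ?opnorm_ge0 // ltW.
      rewrite -[leRHS](mulr0 (e.+1 ^ 2)%:R); apply: opnorm_le_entries => // k l.
      by rewrite mxE normr0.
  have := Qmax (Q0, P0) (conj AQP0 ker0); rewrite /= mxE intrM normrM !lerN2.
  have : 0 < `|(Q0 i j)%:~R : R| by rewrite normr_gt0 intr_eq0.
  have -> : `|2%:~R : R| = 2 by rewrite normr_nat.
  lra.
(* For [N > c], [Q = 0] would leave an integral [P] with entries below 1, so [P = 0], against
   invertibility. *)
have approxA N : 1 <= N -> c < N -> exists2 QP, A QP & opnorm (err QP) <= c / N.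
  move=> N1 cN; have N0 : 0 < N := lt_le_trans ltr01 N1.
  have [Q [P [QPu QP errQP QN]]] := approx X N symX N1.
  exists (Q, P) => //; have Qnz : Q != 0.
    apply/negP => /eqP Q0; move: QPu errQP.
    rewrite Q0 mul0mx add0r map_mx0 mul0mx add0r => Pu /(le_trans (opnorm_ge_entry _ _ _)) Pc.
    suff P0 : P = 0 by move: Pu; rewrite P0 mul0mx map_mx0 unitr0.
    apply/matrixP => i j; rewrite [RHS]mxE; have := Pc i j; rewrite mxE -intr_norm.
    have : c / N < 1 by rewrite ltr_pdivrMr ?mul1r.
    move=> /[swap] /le_lt_trans/[apply]; rewrite -[1]/(1%:~R) ltr_int; lia.
  split=> //; apply: le_trans errQP _; rewrite ler_pM2l // lef_pV2 ?posrE //.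
  apply/opnorm_gt0/(contra_neq _ Qnz) => /matrixP Qr; apply/matrixP => i j.
  by have /eqP := Qr i j; rewrite !mxE intr_eq0 => /eqP.
have [||x0 Ax0 _] := approxA (c + 1); [by lra|by lra|].
(* The smallest error is positive; an [N] beyond [c] divided by it produces a smaller one. The
   summands [c + 1] below secure [1 <= N] and [c < N]. *)
have [x Ax xmin] := finite_argmin (fun QP => opnorm (err QP)) Afin Ax0.
have x_gt0 : 0 < opnorm (err x).
  by apply/opnorm_gt0/eqP => x0'; apply: noker; exists x.
have cx : 0 < c / opnorm (err x) by rewrite divr_gt0.
have [||y Ay] := approxA (c / opnorm (err x) + c + 1); [by lra|by lra|].
move/(le_trans (xmin y Ay)); rewrite ler_pdivlMr; last by lra.
by rewrite -addrA mulrDr mulrCA divff ?gt_eqF // mulr1; nra.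
Qed.
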